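(* Let $\mathbf E$ be a pointed geodesic compact metric space. Then $\mathrm{Kac}(\mathbf E)$ is a compact $\mathbb R$-tree.
   Context: **Geodesic spaces.** A metric space $(E,d)$ is geodesic if for every $a,b\in E$ there is a curve $\gamma:[0,d(a,b)]\to E$ with $\gamma(0)=a$, $\gamma(d(a,b))=b$ and $d(\gamma(s),\gamma(t))=t-s$ for $0\leq s\le t\leq d(a,b)$. **Continuous cactus.** For a pointed geodesic compact metric space $\mathbf E=(E,d,\rho)$ and $a,b\in E$ put $$d^{\mathbf E}_{\mathrm{Kac}}(a,b)=d(\rho,a)+d(\rho,b)-2\sup_{\gamma:a\to b}\min_{0\le t\le1}d(\rho,\gamma(t)),$$ the supremum being over continuous curves $\gamma:[0,1]\to E$ with $\gamma(0)=a,\gamma(1)=b$. This is a pseudo-distance; $\mathrm{Kac}(\mathbf E)$ is the quotient of $E$ by $\{d^{\mathbf E}_{\mathrm{Kac}}=0\}$ with the induced distance. *)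

(* Defs.v *)
From HB Require Import structures.
From mathcomp Require Import all_boot all_order all_algebra generic_quotient.
From mathcomp Require Import all_classical all_reals all_analysis.
From mathcomp Require Import ring lra.
Import Order.TTheory GRing.Theory Num.Theory numFieldNormedType.Exports.

Set Implicit Arguments.
Unset Strict Implicit.
Unset Printing Implicit Defensive.

Local Open Scope classical_set_scope.
Local Open Scope ring_scope.
Local Open Scope quotient_scope.

(* A curve on a segment is a total function [R -> E] of which only the values
   on the segment are constrained. *)
Definition geodesic_curve (R : realType) (E : metricType R) (a b : E)
    (g : R -> E) : Prop :=
  [/\ g 0 = a, g (mdist a b) = b &
      forall s t, 0 <= s -> s <= t -> t <= mdist a b ->
        mdist (g s) (g t) = t - s].

Definition geodesic_space (R : realType) (E : metricType R) : Prop :=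
  forall a b : E, exists g, geodesic_curve a b g.

Record pointedGeodesicCompact (R : realType) := PointedGeodesicCompact {
  pgc_sort :> metricType R;
  pgc_root : pgc_sort;
  pgc_geodesic : geodesic_space pgc_sort;
  pgc_compact : compact [set: pgc_sort] }.

Definition curve (R : realType) (E : metricType R) (a b : E) (g : R -> E) :
    Prop :=
  [/\ {within `[0, 1], continuous g}, g 0 = a & g 1 = b].

(* The infimum is a minimum when [g] is continuous on [[0, 1]]; see
   [min_height_attained]. *)
Definition min_height (R : realType) (E : metricType R) (rho : E)
    (g : R -> E) : R :=
  inf [set mdist rho (g t) | t in `[0, 1]].

Definition kac_heights (R : realType) (E : pointedGeodesicCompact R)
    (a b : E) : set R :=
  [set min_height (pgc_root E) g | g in curve a b].

Definition dKac (R : realType) (E : pointedGeodesicCompact R) (a b : E) : R :=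
  mdist (pgc_root E) a + mdist (pgc_root E) b - 2 * sup (kac_heights a b).

Lemma mdist_continuous (R : realType) (E : metricType R) (rho : E) :
  continuous (mdist rho : E -> R).
Proof.
move=> x; apply/cvgrPdist_lt => e e0.
have : nbhs x (ball x e) by exact: nbhsx_ballx.
apply: filterS => y; rewrite ballEmdist /= => xy.
have h1 := metric_triangle rho x y; have h2 := metric_triangle rho y x.
by rewrite (metric_sym y x) in h2; rewrite ltr_norml; apply/andP; split; lra.
Qed.

Lemma min_height_attained (R : realType) (E : metricType R) (rho a b : E)
    (g : R -> E) : curve a b g ->
  exists2 t, 0 <= t <= 1 & min_height rho g = mdist rho (g t).
Proof.
move=> [cg _ _].
have cf : {within `[0, 1], continuous (fun t : R => mdist rho (g t))}.
  by move=> x; apply: continuous_comp; [exact: cg|exact: mdist_continuous].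
have [c c01 cmin] := EVT_min ler01 cf.
exists c; first by move: c01; rewrite in_itv.
apply/eqP; rewrite eq_le; apply/andP; split.
  apply: ge_inf; last by exists c.
  by exists 0 => _ [t _ <-]; exact: mdist_ge0.
apply: lb_le_inf; first by exists (mdist rho (g c)), c.
by move=> _ [t t01 <-]; exact: cmin.
Qed.

Lemma min_height_le (R : realType) (E : metricType R) (rho : E)
    (g : R -> E) t : 0 <= t <= 1 -> min_height rho g <= mdist rho (g t).
Proof.
move=> t01; apply: ge_inf; last by exists t => //=; rewrite in_itv.
by exists 0 => _ [u _ <-]; exact: mdist_ge0.
Qed.

Lemma geodesic_space_curve (R : realType) (E : metricType R) (a b : E) :
  geodesic_space E -> exists g, curve a b g.
Proof.
move=> /(_ a b)[g [g0 g1 gd]]; set D := mdist a b in g1 gd.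
have D0 : 0 <= D by exact: mdist_ge0.
exists (fun t => g (t * D)); split; rewrite ?mul0r ?mul1r//.
have lip (s t : R) : 0 <= s <= 1 -> 0 <= t <= 1 ->
    mdist (g (s * D)) (g (t * D)) <= `|s - t| * D.
  wlog st : s t / s <= t.
    move=> h s01 t01; have [st|/ltW ts] := leP s t; first exact: h.
    by rewrite metric_sym distrC; exact: h.
  move=> /andP[s0 s1] /andP[t0 t1].
  rewrite gd ?mulr_ge0 ?ler_wpM2r// ?ler_piMl//.
  by rewrite distrC ger0_norm ?subr_ge0// mulrBl.
apply/subspace_continuousP => x x01.
apply/metricType_numDomainType.cvgrPdist_lt => e e0.
have D1 : 0 < D + 1 by lra.
have eD : 0 < e / (D + 1) by rewrite divr_gt0.
rewrite near_withinE.
have := @nbhsx_ballx _ R^o x _ eD; apply: filterS => t xt t01.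
rewrite /= !in_itv/= in x01 t01.
apply: le_lt_trans (lip _ _ x01 t01) _.
apply: (@le_lt_trans _ _ (`|x - t| * (D + 1))).
  by rewrite ler_wpM2l//; lra.
by rewrite -ltr_pdivlMr.
Qed.

Lemma curve_cst (R : realType) (E : metricType R) (a : E) :
  curve a a (fun=> a).
Proof. by split=> //; apply: continuous_subspaceT => x; exact: cvg_cst. Qed.

Lemma within_continuous_reparam (R : realType) (E : metricType R)
    (A B : set R) (g : R -> E) (h : R -> R) :
  continuous h -> (forall x, A x -> B (h x)) ->
  {within B, continuous g} -> {within A, continuous (g \o h)}.
Proof.
move=> ch AB /subspace_continuousP cg; apply/subspace_continuousP => x Ax.
apply: cvg_comp (cg _ (AB _ Ax)) => W /= hW.
have := ch x _ hW; rewrite !nbhs_simpl /= /within /=.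
by apply: filterS => y + Ay; apply; exact: AB.
Qed.

Lemma curve_rev (R : realType) (E : metricType R) (a b : E) (g : R -> E) :
  curve a b g -> curve b a (g \o (fun t => 1 - t)).
Proof.
move=> [cg g0 g1]; split; rewrite /= ?subr0 ?subrr//.
apply: within_continuous_reparam cg => [x|x /=].
  by apply: cvgB; [exact: cvg_cst|exact: cvg_id].
by rewrite !in_itv /= => /andP[? ?]; apply/andP; split; lra.
Qed.

Definition curve_cat (R : realType) (E : metricType R) (g h : R -> E) (t : R) :
    E :=
  if t <= 2^-1 then g (2 * t) else h (2 * t - 1).

Lemma curve_cat_curve (R : realType) (E : metricType R) (a b c : E)
    (g h : R -> E) :
  curve a b g -> curve b c h -> curve a c (curve_cat g h).
Proof.
move=> [cg g0 g1] [ch h0 h1]; split; last 2 first.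
- by rewrite /curve_cat ifT ?mulr0//; lra.
- rewrite /curve_cat ifF; last by apply/negP; lra.
  by rewrite -h1; congr h; lra.
have -> : [set` `[0, 1]] = [set` `[0, 2^-1]] `|` [set` `[2^-1, 1]] :> set R.
  apply/seteqP; split => [x|x []] /=; rewrite !in_itv /=.
  - by move=> /andP[? ?]; have [?|?] := leP x 2^-1; [left|right]; lra.
  - by move=> /andP[? ?]; lra.
  - by move=> /andP[? ?]; lra.
have c2 : continuous (fun t : R => 2 * t).
  by move=> x; apply: cvgM; [exact: cvg_cst|exact: cvg_id].
apply: withinU_continuous; [exact: itv_closed|exact: itv_closed| |].
- apply: (@subspace_eq_continuous _ _ _ (g \o (fun t => 2 * t))).
    move=> x; rewrite inE /= in_itv /= => /andP[? ?].
    by rewrite /from_subspace /curve_cat /= ifT.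
  apply: within_continuous_reparam c2 _ cg => x /=.
  by rewrite !in_itv /= => /andP[? ?]; apply/andP; split; lra.
- apply: (@subspace_eq_continuous _ _ _ (h \o (fun t => 2 * t - 1))).
    move=> x; rewrite inE /= in_itv /= => /andP[x2 _].
    rewrite /from_subspace /curve_cat /=; case: ifPn => // x2'.
    have -> : x = 2^-1 by apply/eqP; rewrite eq_le x2 x2'.
    by rewrite divff ?subrr ?g1 ?h0.
  apply: within_continuous_reparam ch => [x|x /=].
    by apply: cvgB; [exact: c2|exact: cvg_cst].
  by rewrite !in_itv /= => /andP[? ?]; apply/andP; split; lra.
Qed.

Lemma min_height_rev (R : realType) (E : metricType R) (rho : E)
    (g : R -> E) : min_height rho (g \o (fun t => 1 - t)) = min_height rho g.
Proof.
congr inf; apply/seteqP; split => _ [t + <-] /=; rewrite /= in_itv /= => t01.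
  by exists (1 - t) => //=; rewrite in_itv /=; lra.
by exists (1 - t); rewrite /= ?in_itv /= ?subKr//; lra.
Qed.

Lemma min_height_cat (R : realType) (E : metricType R) (rho a b c : E)
    (g h : R -> E) : curve a b g -> curve b c h ->
  Num.min (min_height rho g) (min_height rho h) <=
    min_height rho (curve_cat g h).
Proof.
move=> cg ch; have [t /andP[t0 t1] ->] :=
  min_height_attained rho (curve_cat_curve cg ch).
rewrite ge_min /curve_cat; have [t2|t2] := leP t 2^-1.
  by rewrite min_height_le//; apply/andP; split; lra.
by rewrite (@min_height_le _ _ _ h) ?orbT//; apply/andP; split; lra.
Qed.

Lemma kac_heights_ubound (R : realType) (E : pointedGeodesicCompact R)
    (a b : E) :
  ubound (kac_heights a b) (mdist (pgc_root E) a).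
Proof.
by move=> _ [g [_ <- _] <-]; apply: min_height_le; rewrite lexx ler01.
Qed.

Lemma kac_heights_has_sup (R : realType) (E : pointedGeodesicCompact R)
    (a b : E) : has_sup (kac_heights a b).
Proof.
split; last by exists (mdist (pgc_root E) a); exact: kac_heights_ubound.
have [g cg] := geodesic_space_curve a b (@pgc_geodesic _ E).
by exists (min_height (pgc_root E) g), g.
Qed.

Lemma kac_heightsC (R : realType) (E : pointedGeodesicCompact R) (a b : E) :
  kac_heights a b = kac_heights b a.
Proof.
apply/seteqP; split => _ [g cg <-]; exists (g \o (fun t => 1 - t));
  by [exact: curve_rev|rewrite min_height_rev].
Qed.

Lemma dKacxx (R : realType) (E : pointedGeodesicCompact R) (a : E) :
  dKac a a = 0.
Proof.
rewrite /dKac; suff -> : sup (kac_heights a a) = mdist (pgc_root E) a.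
  by lra.
apply/eqP; rewrite eq_le; apply/andP; split.
  apply: ge_sup; last exact: kac_heights_ubound.
  by have [] := kac_heights_has_sup a a.
have [t _ <-] := min_height_attained (pgc_root E) (curve_cst a).
apply: ub_le_sup; first by have [] := kac_heights_has_sup a a.
by exists (fun=> a) => //; exact: curve_cst.
Qed.

Lemma dKacC (R : realType) (E : pointedGeodesicCompact R) (a b : E) :
  dKac a b = dKac b a.
Proof. by rewrite /dKac kac_heightsC; lra. Qed.

Lemma dKac_triangle (R : realType) (E : pointedGeodesicCompact R)
    (b a c : E) : dKac a c <= dKac a b + dKac b c.
Proof.
have [nab _] := kac_heights_has_sup a b.
have [nbc _] := kac_heights_has_sup b c.
have sab : sup (kac_heights a b) <= mdist (pgc_root E) b.
  by apply: ge_sup => //; rewrite kac_heightsC; exact: kac_heights_ubound.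
have sbc : sup (kac_heights b c) <= mdist (pgc_root E) b.
  by apply: ge_sup => //; exact: kac_heights_ubound.
suff sac : Num.min (sup (kac_heights a b)) (sup (kac_heights b c)) <=
    sup (kac_heights a c).
  by move: sac; rewrite ge_min /dKac => /orP[]; lra.
apply/ler_addgt0Pl => e e0.
have [_ [g cg <-] ge] := sup_adherent e0 (kac_heights_has_sup a b).
have [_ [h ch <-] he] := sup_adherent e0 (kac_heights_has_sup b c).
have ac : min_height (pgc_root E) (curve_cat g h) <= sup (kac_heights a c).
  apply: ub_le_sup; first by have [] := kac_heights_has_sup a c.
  by exists (curve_cat g h) => //; exact: curve_cat_curve cg ch.
have := min_height_cat (pgc_root E) cg ch.
by rewrite !ge_min => /orP[] ?; apply/orP; [left|right]; lra.
Qed.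

Lemma dKac_ge0 (R : realType) (E : pointedGeodesicCompact R) (a b : E) :
  0 <= dKac a b.
Proof. by have := dKac_triangle b a a; rewrite dKacxx (dKacC b a); lra. Qed.

Definition kac_rel (R : realType) (E : pointedGeodesicCompact R) : rel E :=
  fun a b => dKac a b == 0.

Lemma kac_rel_refl (R : realType) (E : pointedGeodesicCompact R) :
  reflexive (@kac_rel R E).
Proof. by move=> a; rewrite /kac_rel dKacxx. Qed.

Lemma kac_rel_sym (R : realType) (E : pointedGeodesicCompact R) :
  symmetric (@kac_rel R E).
Proof. by move=> a b; rewrite /kac_rel dKacC. Qed.

Lemma kac_rel_trans (R : realType) (E : pointedGeodesicCompact R) :
  transitive (@kac_rel R E).
Proof.
move=> b a c /eqP ab /eqP bc; rewrite /kac_rel eq_le dKac_ge0 andbT.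
by rewrite (le_trans (dKac_triangle b a c))// ab bc addr0.
Qed.

Definition kac_equiv (R : realType) (E : pointedGeodesicCompact R) :
    equiv_rel E :=
  EquivRel (@kac_rel R E) (@kac_rel_refl R E) (@kac_rel_sym R E)
    (@kac_rel_trans R E).

Definition Kac (R : realType) (E : pointedGeodesicCompact R) : Type :=
  {eq_quot kac_equiv E}.

HB.instance Definition _ (R : realType) (E : pointedGeodesicCompact R) :=
  Choice.on (Kac E).
HB.instance Definition _ (R : realType) (E : pointedGeodesicCompact R) :=
  Quotient.on (Kac E).

(* Independent of the representatives; see [mdist_Kac]. *)
Definition Kac_dist (R : realType) (E : pointedGeodesicCompact R)
    (x y : Kac E) : R := dKac (repr x) (repr y).

Lemma Kac_dist_pi (R : realType) (E : pointedGeodesicCompact R) (a b : E) :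
  Kac_dist (\pi_(Kac E) a) (\pi_(Kac E) b) = dKac a b.
Proof.
have rep (c : E) : dKac (repr (\pi_(Kac E) c)) c = 0.
  by apply/eqP; apply/(@eqmodP _ (kac_equiv E)); rewrite reprK.
have le (x x' y y' : E) : dKac x x' = 0 -> dKac y y' = 0 ->
    dKac x y <= dKac x' y'.
  move=> xx yy; have h1 := dKac_triangle x' x y.
  by have h2 := dKac_triangle y' x' y; rewrite (dKacC y' y) in h2; lra.
apply/eqP; rewrite eq_le; apply/andP; split; apply: le => //;
  by rewrite ?[dKac a _]dKacC ?[dKac b _]dKacC rep.
Qed.

Lemma Kac_distxx (R : realType) (E : pointedGeodesicCompact R) (x : Kac E) :
  Kac_dist x x = 0.
Proof. exact: dKacxx. Qed.

Lemma Kac_dist_positivity (R : realType) (E : pointedGeodesicCompact R)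
    (x y : Kac E) : Kac_dist x y = 0 -> x = y.
Proof.
by move=> xy; rewrite -[x]reprK -[y]reprK; apply/eqmodP/eqP.
Qed.

Lemma Kac_distC (R : realType) (E : pointedGeodesicCompact R) (x y : Kac E) :
  Kac_dist x y = Kac_dist y x.
Proof. exact: dKacC. Qed.

Lemma Kac_dist_triangle (R : realType) (E : pointedGeodesicCompact R)
    (y x z : Kac E) : Kac_dist x z <= Kac_dist x y + Kac_dist y z.
Proof. exact: dKac_triangle. Qed.

HB.instance Definition _ (R : realType) (E : pointedGeodesicCompact R) :=
  @isMetric.Build R (Kac E) (@Kac_dist R E) (@Kac_distxx R E)
    (@Kac_dist_positivity R E) (@Kac_distC R E) (@Kac_dist_triangle R E).

Lemma mdist_Kac (R : realType) (E : pointedGeodesicCompact R) (a b : E) :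
  mdist (\pi_(Kac E) a : Kac E) (\pi_(Kac E) b) = dKac a b.
Proof. exact: Kac_dist_pi. Qed.

(* Any two points are joined by a unique isometric embedding of a segment, and
   every injective curve joining them has the same range. *)
Definition isRTree (R : realType) (T : metricType R) : Prop :=
  forall a b : T, exists f : R -> T,
    [/\ geodesic_curve a b f,
        forall g, geodesic_curve a b g -> {in `[0, mdist a b], g =1 f} &
        forall q, curve a b q -> {in `[0, 1] &, injective q} ->
          q @` `[0, 1] = f @` `[0, mdist a b]].

(* Main.v *)
(* The supremum of min-heights is ultrametric, because curves concatenate, and
   it is the Gromov product of [dKac] at the root; hence [Kac E] satisfies the
   four-point condition.  Since [dKac <= mdist], [Kac E] is a Lipschitz image
   of [E], and geodesics of [E] issued from the root stay geodesics in [Kac E].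
   Those towards [a] and [b] agree in [Kac E] up to height
   [sup (kac_heights a b)], and the two remaining parts form a geodesic from [a]
   to [b].  In a geodesic space with the four-point condition, a connected set
   containing two points contains the segment between them, and this gives the
   R-tree property. *)
Require Import Defs.
From mathcomp Require Import all_boot all_order all_algebra.
From mathcomp Require Import all_classical all_reals all_analysis.
From mathcomp Require Import generic_quotient lra.
Import Order.TTheory GRing.Theory Num.Theory numFieldNormedType.Exports.

Set Implicit Arguments.
Unset Strict Implicit.
Unset Printing Implicit Defensive.

Local Open Scope classical_set_scope.
Local Open Scope ring_scope.
Local Open Scope quotient_scope.

(** * Metric spaces satisfying the four-point condition *)

Definition four_point (R : realType) (T : metricType R) : Prop :=
  forall a b x y : T,
    mdist x y + mdist a b <=
      Num.max (mdist a x + mdist b y) (mdist a y + mdist b x).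

(** When [d(u, v) = h(u) + h(v) - 2 m(u, v)], the terms in [h] cancel and this inequality becomes
    the four-point condition for [d]. *)
Lemma four_point_ultrametric (R : realType) (T : Type) (m : T -> T -> R) :
  (forall a b, m a b = m b a) ->
  (forall a b c, Num.min (m a b) (m b c) <= m a c) ->
  forall a b x y,
    Num.min (m a x + m b y) (m a y + m b x) <= m x y + m a b.
Proof.
move=> mC mu a b x y.
move: (mu x a y) (mu x b y) (mu a x b) (mu a y b).
rewrite !(mC x a) !(mC x b) !(mC y b) !ge_min.
by move=> /orP[] ? /orP[] ? /orP[] ? /orP[] ?; apply/orP;
  have [?|?] := leP (m a x + m b y) (m a y + m b x);
  first [by left; lra|by right; lra].
Qed.

(* A Gromov product [(a|u)_x > 0] expresses that [a] and [u] are in the same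
   component of the complement of [x]; [p] below is twice this product. *)
Lemma four_point_connected (R : realType) (T : metricType R) (A : set T)
    (a b x : T) :
  four_point T -> connected A -> A a -> A b ->
  mdist a x + mdist x b = mdist a b -> A x.
Proof.
move=> fp cA Aa Ab axb; apply: contrapT => nAx.
pose p u v : R := mdist x u + mdist x v - mdist u v.
(* The four-point condition bounds [p u w] below by the minimum of [p u v] and [p v w]. *)
have p_min u v w : 0 < p u v -> 0 < p v w -> 0 < p u w.
  rewrite /p => uv vw; have := fp x v u w.
  rewrite (metric_sym v u) le_max => /orP[]; lra.
have p_near u v : mdist u v < mdist x u -> 0 < p u v.
  by rewrite /p; have := mdist_ge0 x v; lra.
have near_ball (u : T) : u != x -> nbhs u [set v | 0 < p u v].
  rewrite eq_sym -mdist_gt0 => xu.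
  have : nbhs u (ball u (mdist x u)) by exact: nbhsx_ballx.
  apply: filterS => v.
  by rewrite ballEmdist; exact: p_near.
have neq_pos u v : 0 < p u v -> v != x.
  apply: contraTneq => ->; rewrite /p mdistxx (metric_sym u x); lra.
have pC u v : p u v = p v u by rewrite /p (metric_sym v u); lra.
have oB : open [set u | 0 < p a u].
  rewrite openE => u /= au; apply: filterS (near_ball u (neq_pos _ _ au)) => v.
  exact: p_min.
have oC : open [set u | u != x /\ ~ 0 < p a u].
  rewrite openE => u /= [ux au]; apply: filterS (near_ball u ux) => v /= uv.
  split; first exact: neq_pos uv.
  by move=> av; apply: au; apply: p_min av _; rewrite pC.
(* Since [x] is not in [A], the two open sets cover [A]; the component of [a] is thus clopen in
   [A]. *)
have eqA : A `&` [set u | 0 < p a u] = A.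
  apply: cA.
  - exists a; split=> //=; rewrite /p mdistxx.
    suff : x != a by rewrite -mdist_gt0; lra.
    by apply: contra_notN nAx => /eqP ->.
  - by exists [set u | 0 < p a u].
  - exists (~` [set u | u != x /\ ~ 0 < p a u]); first exact: open_closedC.
    apply/seteqP; split=> u [Au /= pu]; split=> //=; first by case.
    apply: contrapT => npu; apply: pu; split=> //.
    by apply: contra_notN nAx => /eqP <-.
(* As [x] lies between [a] and [b], [p a b = 0]. *)
have : (A `&` [set u | 0 < p a u]) b by rewrite eqA.
by move=> [_ /=]; rewrite /p (metric_sym x a); lra.
Qed.

(** Both sums in the maximum equal [mdist a b], which leaves [mdist x y <= 0]. *)
Lemma four_point_between_unique (R : realType) (T : metricType R) (a b x y : T) :
  four_point T -> mdist a x + mdist x b = mdist a b ->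
  mdist a y + mdist y b = mdist a b -> mdist a x = mdist a y -> x = y.
Proof.
move=> fp abx aby xy; apply: mdist_positivity; apply/eqP.
rewrite eq_le mdist_ge0 andbT; have := fp a b x y.
by rewrite le_max (metric_sym b x) (metric_sym b y) => /orP[]; lra.
Qed.

(** The prescribed [mdist a p] is the Gromov product of [y] and [b] at [a]. It makes the two sums in
    the maximum equal, and the resulting bound on [mdist y p] turns both triangle inequalities into
    equalities. *)
Lemma four_point_projection (R : realType) (T : metricType R) (a b p y : T) :
  four_point T -> mdist a p + mdist p b = mdist a b ->
  mdist a p = (mdist a y + mdist a b - mdist y b) / 2 ->
  mdist a p + mdist p y = mdist a y /\ mdist y p + mdist p b = mdist y b.
Proof.
move=> fp abp ap; have := fp a b y p.
have := metric_triangle a p y; have := metric_triangle y p b.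
by rewrite (metric_sym p y) (metric_sym b p) (metric_sym b y) le_max =>
  ? ? /orP[] ?; split; lra.
Qed.

Lemma geodesic_curve_between (R : realType) (T : metricType R) (a b : T)
    (f : R -> T) (s : R) :
  geodesic_curve a b f -> 0 <= s <= mdist a b ->
  mdist a (f s) = s /\ mdist (f s) b = mdist a b - s.
Proof.
by move=> [f0 f1 fd] /andP[s0 s1]; split; [rewrite -{1}f0|rewrite -{1}f1];
  rewrite fd//; lra.
Qed.

Lemma four_point_RTree (R : realType) (T : metricType R) :
  geodesic_space T -> four_point T -> isRTree T.
Proof.
move=> geo fp a b; have [f fab] := geo a b; exists f; split=> //.
  move=> g gab s; rewrite in_itv /= => s01.
  have [fs1 fs2] := geodesic_curve_between fab s01.
  have [gs1 gs2] := geodesic_curve_between gab s01.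
  by apply: (four_point_between_unique (a := a) (b := b)) => //; lra.
move=> q [cq q0 q1] qinj.
have conn u v : 0 <= u -> v <= 1 -> connected (q @` `[u, v]).
  move=> u0 v1; apply: connected_continuous_connected.
    exact: segment_connected.
  apply: continuous_subspaceW cq => t /=; rewrite !in_itv /=; lra.
apply/seteqP; split; last first.
  move=> _ [s + <-]; rewrite /= in_itv /= => s01.
  have [fs1 fs2] := geodesic_curve_between fab s01.
  apply: (@four_point_connected _ _ (q @` `[0, 1]) a b) => //; last by lra.
  - exact: conn.
  - by exists 0 => //=; rewrite in_itv /= lexx ler01.
  - by exists 1 => //=; rewrite in_itv /= lexx ler01.
move=> _ [t + <-]; rewrite /= in_itv /= => /andP[t0 t1].
set y := q t.
pose s := (mdist a y + mdist a b - mdist y b) / 2.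
have s01 : 0 <= s <= mdist a b.
  have := metric_triangle a b y; have := metric_triangle a y b.
  have := metric_triangle y a b; rewrite (metric_sym b y) (metric_sym y a) /s.
  by move=> ? ? ?; apply/andP; split; lra.
have [fs1 fs2] := geodesic_curve_between fab s01.
have [ay yb] : mdist a (f s) + mdist (f s) y = mdist a y /\
    mdist y (f s) + mdist (f s) b = mdist y b.
  by apply: four_point_projection => //; lra.
(* The projection of [y] to the segment is visited both before and after [t],
   so that injectivity forces it to be [y]. *)
have [t1' t1t q1s] : (q @` `[0, t]) (f s).
  apply: (@four_point_connected _ _ (q @` `[0, t]) a y) => //; first exact: conn.
  - by exists 0 => //=; rewrite in_itv /= lexx.
  - by exists t => //=; rewrite in_itv /= lexx andbT.
have [t2' t2t q2s] : (q @` `[t, 1]) (f s).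
  apply: (@four_point_connected _ _ (q @` `[t, 1]) y b) => //; first exact: conn.
  - by exists t => //=; rewrite in_itv /= lexx.
  - by exists 1 => //=; rewrite in_itv /= lexx andbT.
rewrite /= !in_itv /= in t1t t2t.
have t12 : t1' = t2'.
  by apply: qinj; rewrite ?in_itv /= ?q1s ?q2s//; lra.
exists s; first by rewrite /= in_itv.
by rewrite -q1s /y; congr q; lra.
Qed.

(** The bounds on [[0, s]], [[s, t]] and [[t, mdist a b]] add up to the distance of the endpoints,
    so none is strict. *)
Lemma lipschitz_geodesic (R : realType) (T : metricType R) (a b : T)
    (f : R -> T) :
  f 0 = a -> f (mdist a b) = b ->
  (forall s t, 0 <= s -> s <= t -> t <= mdist a b ->
    mdist (f s) (f t) <= t - s) ->
  geodesic_curve a b f.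
Proof.
move=> f0 f1 flip; split=> // s t s0 st tD.
have := flip s t s0 st tD; have := flip 0 s (lexx _) s0 (le_trans st tD).
have := flip t _ (le_trans s0 st) tD (lexx _); rewrite f0 f1.
have := metric_triangle a (f s) b; have := metric_triangle (f s) (f t) b.
by lra.
Qed.

(** * Heights of curves and comparison of [dKac] with the distance *)

Definition kac_height (R : realType) (E : pointedGeodesicCompact R) (a b : E) :
  R := sup (kac_heights a b).

Lemma kac_heightC (R : realType) (E : pointedGeodesicCompact R) (a b : E) :
  kac_height a b = kac_height b a.
Proof. by rewrite /kac_height kac_heightsC. Qed.

Lemma kac_height_ultrametric (R : realType) (E : pointedGeodesicCompact R)
    (a b c : E) :
  Num.min (kac_height a b) (kac_height b c) <= kac_height a c.
Proof.
apply/ler_addgt0Pl => e e0.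
have [_ [g cg <-] ge] := sup_adherent e0 (kac_heights_has_sup a b).
have [_ [h ch <-] he] := sup_adherent e0 (kac_heights_has_sup b c).
have ac : min_height (pgc_root E) (curve_cat g h) <= kac_height a c.
  apply: ub_le_sup; first by have [] := kac_heights_has_sup a c.
  by exists (curve_cat g h) => //; exact: curve_cat_curve cg ch.
have := min_height_cat (pgc_root E) cg ch; rewrite /kac_height in ac *.
by rewrite !ge_min => /orP[] ?; apply/orP; [left|right]; lra.
Qed.

Lemma kac_height_le (R : realType) (E : pointedGeodesicCompact R) (a b : E) :
  kac_height a b <= mdist (pgc_root E) a.
Proof.
by apply: ge_sup; [have [] := kac_heights_has_sup a b|
  exact: kac_heights_ubound].
Qed.

Lemma lipschitz_within_continuous (R : realType) (E : metricType R)
    (D : R) (g : R -> E) :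
  (forall s t, 0 <= s -> s <= t -> t <= D -> mdist (g s) (g t) <= t - s) ->
  {within `[0, D], continuous g}.
Proof.
move=> glip; apply/subspace_continuousP => x xD.
apply/metricType_numDomainType.cvgrPdist_lt => e e0.
rewrite near_withinE; apply: filterS (@nbhsx_ballx _ R^o x _ e0) => t xt tD.
move: xD tD; rewrite /= !in_itv /= => /andP[x0 xD] /andP[t0 tD].
move: xt; rewrite /ball /= => xt.
have [xlet|/ltW tlex] := leP x t.
  by apply: le_lt_trans (glip _ _ x0 xlet tD) _; rewrite ltr_norml in xt; lra.
rewrite metric_sym.
by apply: le_lt_trans (glip _ _ t0 tlex xD) _; rewrite ltr_norml in xt; lra.
Qed.

(* At distance [s] from [a] along a geodesic to [b], the height is at least both
   [h(a) - s] and [h(b) - (d(a, b) - s)], hence at least their mean. *)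
Lemma dKac_le_mdist (R : realType) (E : pointedGeodesicCompact R) (a b : E) :
  dKac a b <= mdist a b.
Proof.
have [g gab] := @pgc_geodesic _ E a b; have [g0 g1 gd] := gab.
have D0 := mdist_ge0 a b.
set D := mdist a b in g1 gd D0 *; set rho := pgc_root E.
pose k := g \o (fun t => t * D).
have hD (t : R) : 0 <= t <= 1 -> 0 <= t * D <= D.
  by move=> /andP[t0 t1]; rewrite mulr_ge0 //= ler_piMl.
have ck : curve a b k.
  split; rewrite /k /= ?mul0r ?mul1r//.
  apply: (@within_continuous_reparam _ _ _ [set` `[0, D]]).
  - by move=> x; apply: cvgM; [exact: cvg_id|exact: cvg_cst].
  - by move=> x; rewrite /= !in_itv /=; exact: hD.
  - by apply: lipschitz_within_continuous => s t *; rewrite gd.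
have [t t01 kt] := min_height_attained rho ck.
have : min_height rho k <= kac_height a b.
  by apply: ub_le_sup; [have [] := kac_heights_has_sup a b|exists k].
have [] := geodesic_curve_between gab (hD t t01); rewrite -/D.
have := metric_triangle rho (k t) a; have := metric_triangle rho (k t) b.
rewrite kt /dKac -/(kac_height a b) (metric_sym (k t) a) /k /= -/rho; lra.
Qed.

(** * Compactness, four-point condition and geodesics of the cactus *)

Lemma Kac_compact (R : realType) (E : pointedGeodesicCompact R) :
  compact [set: Kac E].
Proof.
have -> : [set: Kac E] = (\pi_(Kac E) : E -> Kac E) @` [set: E].
  by apply/seteqP; split=> // x _; exists (repr x) => //; rewrite reprK.
apply: continuous_compact (@pgc_compact _ E).
apply: continuous_subspaceT => x.
apply/metricType_numDomainType.cvgrPdist_lt => e e0.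
have : nbhs x (ball x e) by exact: nbhsx_ballx.
apply: filterS => y; rewrite ballEmdist /= => xy.
by rewrite mdist_Kac (le_lt_trans (dKac_le_mdist x y)).
Qed.

Lemma Kac_four_point (R : realType) (E : pointedGeodesicCompact R) :
  four_point (Kac E).
Proof.
move=> a b x y; rewrite -[a]reprK -[b]reprK -[x]reprK -[y]reprK !mdist_Kac.
have := four_point_ultrametric (@kac_heightC R E) (@kac_height_ultrametric R E)
  (repr a) (repr b) (repr x) (repr y).
by rewrite /dKac /kac_height ge_min le_max => /orP[] ?; apply/orP;
  [left|right]; lra.
Qed.

Lemma Kac_geodesic (R : realType) (E : pointedGeodesicCompact R) :
  geodesic_space (Kac E).
Proof.
move=> x y; rewrite -[x]reprK -[y]reprK; move: (repr x) (repr y) => a b {x y}.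
set rho := pgc_root E; pose h := mdist rho; pose m := kac_height a b.
have m_a : m <= h a by exact: kac_height_le.
have m_b : m <= h b by rewrite /m kac_heightC; exact: kac_height_le.
have [f fa] := @pgc_geodesic _ E rho a; have [g gb] := @pgc_geodesic _ E rho b.
have [f0 f1 fd] := fa; have [g0 g1 gd] := gb.
have m0 : 0 <= m.
  have [k ck] := geodesic_space_curve a b (@pgc_geodesic _ E).
  have [t _ kt] := min_height_attained rho ck.
  apply: (@le_trans _ _ (min_height rho k)); first by rewrite kt mdist_ge0.
  by apply: ub_le_sup; [have [] := kac_heights_has_sup a b|exists k].
(* The bound [dKac <= mdist] between [k m] and [c], at distance [h c - m], rearranges to the second
   claim. *)
have kh (c : E) k : geodesic_curve rho c k -> m <= h c ->
    h (k m) = m /\ m <= kac_height (k m) c.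
  move=> kc mc; have := geodesic_curve_between kc (s := m).
  rewrite m0 mc => /(_ isT)[e1 e2]; split=> //.
  by have := dKac_le_mdist (k m) c; rewrite /dKac -/rho e1 e2 /kac_height; lra.
have [fm fma] := kh _ _ fa m_a; have [gm gmb] := kh _ _ gb m_b.
(* The chain [f m], [a], [b], [g m] has all consecutive heights at least [m], so the two geodesics
   meet in the quotient. *)
have fgm : dKac (f m) (g m) = 0.
  apply/eqP; rewrite eq_le dKac_ge0 andbT /dKac -/rho -/(h _) fm -/(h _) gm.
  suff : m <= kac_height (f m) (g m) by rewrite /kac_height; lra.
  apply: le_trans (kac_height_ultrametric _ b _).
  rewrite le_min [kac_height b _]kac_heightC gmb andbT.
  apply: le_trans (kac_height_ultrametric _ a _).
  by rewrite le_min fma lexx.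
have dab : dKac a b = h a + h b - 2 * m by [].
(* Descent along [f] from [a] to height [m], then ascent along [g], whose argument runs from [m] to
   [h b]. *)
pose F (s : R) : Kac E :=
  \pi_(Kac E) (if s <= h a - m then f (h a - s) else g (s - h a + 2 * m)).
exists F; apply: lipschitz_geodesic; rewrite ?mdist_Kac ?dab.
- by rewrite /F ifT ?subr0 ?f1//; lra.
- rewrite /F; case: ifP => [le|_]; last first.
    by congr (\pi_(Kac E) _); rewrite -[RHS]g1 -/(h b); congr g; lra.
  (* here [h b = m]: the part along [g] is reduced to [b] *)
  have hbm : h b = m by lra.
  have -> : h a - (h a + h b - 2 * m) = m by lra.
  have gb' : g m = b by rewrite -[RHS]g1 -/(h b) hbm.
  by rewrite -gb'; apply/eqmodP/eqP.
- move=> s t s0 st tD; rewrite /F mdist_Kac.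
  case: (leP s) => sa; case: (leP t) => ta; last 1 first.
  + by apply: le_trans (dKac_le_mdist _ _) _; rewrite gd//; rewrite -/(h _); lra.
  + by rewrite dKacC; apply: le_trans (dKac_le_mdist _ _) _;
      rewrite fd//; rewrite -/(h _); lra.
  (* Times on either side of the junction: the path passes through [f m] and [g m], at distance
     0. *)
  + apply: le_trans (dKac_triangle (f m) _ _) _.
    have := dKac_triangle (g m) (f m) (g (t - h a + 2 * m)).
    have := dKac_le_mdist (f m) (f (h a - s)).
    have := dKac_le_mdist (g m) (g (t - h a + 2 * m)).
    rewrite fd ?gd //; rewrite -?/(h _) ?fgm ?(dKacC _ (f m)); lra.
  + lra.
Qed.

Theorem corollary2p10 (R : realType) (E : pointedGeodesicCompact R) :
  compact [set: Kac E] /\ isRTree (Kac E).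
Proof.
split; first exact: Kac_compact.
by apply: four_point_RTree; [exact: Kac_geodesic|exact: Kac_four_point].
Qed.
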